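(* Let $\lambda=\lim_{n\to\infty}\lambda_n$ be the cardinal defined by $\lambda_0=\omega_0$ and $\lambda_{n+1}=2^{\lambda_n}$ for $n\ge 0$. Let $X$ be a Banach space of density $\Lambda\ge\lambda$ with a symmetric (long Schauder) basis $\{e_\gamma\}_{\gamma=1}^\Lambda$, and suppose that $X$ coarsely or uniformly embeds into $c_0(\Gamma)$ for some set $\Gamma$. Then $X$ is linearly isomorphic with $c_0(\Lambda)$.
   Context: The density of $X$ is the smallest cardinality of a norm-dense subset of $X$; cardinals are identified with initial ordinals. For a set $\Gamma$ of arbitrary cardinality, $c_0(\Gamma)$ is the Banach space of scalar functions $x$ on $\Gamma$ such that $\{\gamma:|x(\gamma)|>\varepsilon\}$ is finite for all $\varepsilon>0$, with the sup norm. A long Schauder basis of $X$ is a transfinite sequence $\{e_\gamma\}_{\gamma=1}^{\Lambda}$ (indexed by the ordinals $\gamma\in[1,\Lambda)$) such that for every $x\in X$ there is a unique transfinite sequence of scalars $\{a_\gamma\}_{\gamma=1}^\Lambda$ with $x=\sum_{\gamma=1}^\Lambda a_\gamma e_\gamma$ (transfinite sums being norm limits of transfinite partial sums). It is called symmetric if $\big\|\sum_{i=1}^n a_ie_{\gamma_i}\big\|=\big\|\sum_{i=1}^n a_ie_{\beta_i}\big\|$ for all $n\in\mathbb N$, all $a_1,\dots,a_n\in\mathbb R$, and any two families $\{\gamma_i\}_{i=1}^n$, $\{\beta_i\}_{i=1}^n$ in $[1,\Lambda)$, each consisting of $n$ distinct indices. For a map $f:M_1\to M_2$ between metric spaces $(M_1,d_1)$,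 $(M_2,d_2)$ and $t\ge 0$ put $w_f(t)=\sup\{d_2(f(x),f(y)): x,y\in M_1,\ d_1(x,y)\le t\}$ and $\rho_f(t)=\inf\{d_2(f(x),f(y)): x,y\in M_1,\ d_1(x,y)\ge t\}$. The map $f$ is a uniform embedding if $\lim_{t\to0}w_f(t)=0$ and $\rho_f(t)>0$ for every $t>0$. It is a coarse embedding if $w_f(t)<\infty$ for all $0<t<\infty$ and $\lim_{t\to\infty}\rho_f(t)=\infty$. The embeddings are not assumed linear. *)

(* Defs.v *)
From HB Require Import structures.
From mathcomp Require Import all_boot all_order all_algebra.
From mathcomp Require Import all_classical all_reals all_analysis.
From mathcomp Require wochoice.

Set Implicit Arguments.
Unset Strict Implicit.
Unset Printing Implicit Defensive.
Import Order.TTheory GRing.Theory Num.Theory.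
Import numFieldNormedType.Exports.

Local Open Scope classical_set_scope.
Local Open Scope ring_scope.

Fixpoint beth (n : nat) : Type :=
  if n is m.+1 then set (beth m) else nat.

(* The cardinals of the [beth n] increase strictly, so the cardinal of their
   disjoint union is their supremum. *)
Definition beth_omega : Type := {n : nat & beth n}.

Definition has_density (R : numFieldType) (X : normedModType R) (L : Type) :=
  (exists D : set X, dense D /\ (D #= [set: L])%card) /\
  (forall D : set X, dense D -> ([set: L] #<= D)%card).

(* The order type of [L] is an initial ordinal: [L] is well-ordered and no
   proper initial segment has the cardinality of [L].  When [L] is infinite,
   the index set [1, Λ) of a sequence of length Λ = |L| also has order type Λ,
   so that [L] serves as this index set. *)
Definition initial_ordinal (d : Order.disp_t) (L : orderType d) :=
  wochoice.well_order (<=%O : rel L) /\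
  forall a : L, ~~ ([set: L] #<= [set b | (b < a)%O])%card.

Section TransfiniteSum.
Context (d : Order.disp_t) (L : orderType d).

(* [option L] is [L] with a top element [None]; for [L] of order type Λ it
   has order type Λ + 1, i.e. it consists of the ordinals <= Λ. *)
Definition olt (a b : option L) : bool :=
  match a, b with
  | Some x, Some y => (x < y)%O
  | Some _, None => true
  | None, _ => false
  end.

Definition ofirst (a : option L) := forall b, ~~ olt b a.

Definition osucc (b a : option L) :=
  olt b a /\ forall c, ~~ (olt b c && olt c a).

Definition olimit (a : option L) :=
  (exists b, olt b a) /\
  forall b, olt b a -> exists c, olt b c && olt c a.

(* tails of {c | c < a}; used for limit [a] *)
Definition obelow (a : option L) : set_system (option L) :=
  filter_from [set b | olt b a] (fun b => [set c | olt b c && olt c a]).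

(* [S a] is the partial sum over the indices smaller than [a]. *)
Definition is_tsum (R : numFieldType) (X : normedModType R)
    (u : L -> X) (x : X) :=
  exists S : option L -> X,
  [/\ forall a, ofirst a -> S a = 0,
      forall (b : L) a, osucc (Some b) a -> S a = S (Some b) + u b,
      forall a, olimit a -> S c @[c --> obelow a] --> S a
    & S None = x].

Definition long_schauder_basis (R : numFieldType) (X : normedModType R)
    (e : L -> X) :=
  forall x : X, exists! a : L -> R, is_tsum (fun g => a g *: e g) x.

End TransfiniteSum.

Definition symmetric_family (R : numFieldType) (X : normedModType R)
    (L : Type) (e : L -> X) :=
  forall (n : nat) (a : 'I_n -> R) (g b : 'I_n -> L),
    injective g -> injective b ->
    `|\sum_(i < n) a i *: e (g i)| = `|\sum_(i < n) a i *: e (b i)|.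

Definition symmetric_long_schauder_basis (d : Order.disp_t) (L : orderType d)
    (R : numFieldType) (X : normedModType R) (e : L -> X) :=
  long_schauder_basis e /\ symmetric_family e.

Section Embeddings.
Context (R : realType) (X Y : normedModType R).

Definition expansion_modulus (f : X -> Y) (t : R) : \bar R :=
  ereal_sup [set (`|f p.1 - f p.2|)%:E | p in [set p : X * X | `|p.1 - p.2| <= t]].

Definition compression_modulus (f : X -> Y) (t : R) : \bar R :=
  ereal_inf [set (`|f p.1 - f p.2|)%:E | p in [set p : X * X | t <= `|p.1 - p.2|]].

Definition uniform_embedding (f : X -> Y) :=
  expansion_modulus f t @[t --> 0^'+] --> 0%E /\
  forall t : R, 0 < t -> (0 < compression_modulus f t)%E.

Definition coarse_embedding (f : X -> Y) :=
  (forall t : R, 0 < t -> (expansion_modulus f t < +oo)%E) /\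
  compression_modulus f t @[t --> +oo] --> +oo%E.

Definition linearly_isomorphic :=
  exists (T : {linear X -> Y}) (S : {linear Y -> X}),
    [/\ continuous T, continuous S, cancel T S & cancel S T].

End Embeddings.

Section C0.
Context (R : realType) (G : Type).

Definition c0_pred : {pred G -> R} := fun x =>
  `[< forall eps : R, 0 < eps -> finite_set [set g | eps < `|x g|] >].

Lemma c0_submod_closed : submod_closed c0_pred.
Proof.
split=> [|a x y /asboolP x0 /asboolP y0]; apply/asboolP => eps eps0.
  apply: (sub_finite_set (B := set0)) => // g /=.
  by rewrite normr0 ltNge (ltW eps0).
have a0 : 0 < `|a| + 1 by rewrite ltr_wpDl.
have e2 : 0 < eps / 2 by rewrite divr_gt0.
have xf := x0 _ (divr_gt0 e2 a0).
have yf := y0 _ e2.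
apply: sub_finite_set (_ : finite_set (_ `|` _)); last first.
  by rewrite finite_setU; split; [exact: xf | exact: yf].
move=> g /= axy; apply: contrapT => /not_orP[/negP + /negP].
rewrite -!leNgt => xg yg.
have: `|a * x g + y g| <= eps.
  rewrite (splitr eps) (le_trans (ler_normD _ _))// lerD// normrM.
  rewrite (@le_trans _ _ ((`|a| + 1) * `|x g|))//.
    by rewrite ler_wpM2r// lerDl.
  by rewrite mulrC -ler_pdivlMr.
by rewrite leNgt axy.
Qed.

HB.instance Definition _ :=
  GRing.isSubmodClosed.Build R (G -> R) c0_pred c0_submod_closed.

Record c0 := C0 { c0_fun :> G -> R; c0P : c0_fun \in c0_pred }.

HB.instance Definition _ := [isSub for c0_fun].
HB.instance Definition _ := [Choice of c0 by <:].
HB.instance Definition _ := [SubChoice_isSubLmodule of c0 by <:].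

Definition c0_norm (x : c0) : R := sup (range (fun g => `|x g|)).

Lemma c0_has_ubound (x : c0) : has_ubound (range (fun g => `|x g|)).
Proof.
have /asboolP/(_ 1 ltr01) fin := c0P x.
have [M ubM] : has_ubound [set `|x g| | g in [set g | 1 < `|x g|]].
  have /finite_seqP[s ->] := finite_image (fun g => `|x g|) fin.
  elim: s => [|y s [M ubM]]; first by exists 0.
  exists (Num.max y M) => z /=; rewrite inE le_max => /predU1P[->|/ubM ->].
    by rewrite lexx.
  by rewrite orbT.
 exists (Num.max M 1) => _ [g _ <-].
have [gt1|le1] := ltP 1 `|x g|; rewrite le_max ?le1 ?orbT//.
by rewrite ubM//; exists g.
Qed.

Lemma c0_norm_ub (x : c0) (g : G) : `|x g| <= c0_norm x.
Proof. by apply: ub_le_sup; [exact: c0_has_ubound | exists g]. Qed.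

Lemma c0_norm_ge0 (x : c0) : 0 <= c0_norm x.
Proof.
have [|/set0P[_ [g _ _]]] := eqVneq (range (fun g => `|x g|)) set0.
  by rewrite /c0_norm => ->; rewrite sup0.
exact: le_trans (normr_ge0 _) (c0_norm_ub x g).
Qed.

Lemma c0_norm_le (x : c0) (M : R) :
  0 <= M -> (forall g, `|x g| <= M) -> c0_norm x <= M.
Proof.
move=> M0 xM; have [|/set0P ne] := eqVneq (range (fun g => `|x g|)) set0.
  by rewrite /c0_norm => ->; rewrite sup0.
by apply: ge_sup => // _ [g _ <-].
Qed.

Lemma c0_normD (x y : c0) : c0_norm (x + y) <= c0_norm x + c0_norm y.
Proof.
apply: c0_norm_le => [|g]; first by rewrite addr_ge0 ?c0_norm_ge0.
by rewrite (le_trans (ler_normD _ _))// lerD// c0_norm_ub.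
Qed.

Lemma c0_normZ (a : R) (x : c0) : c0_norm (a *: x) = `|a| * c0_norm x.
Proof.
have le b y : c0_norm (b *: y) <= `|b| * c0_norm y.
  apply: c0_norm_le => [|g]; first by rewrite mulr_ge0 ?c0_norm_ge0.
  by rewrite normrM ler_wpM2l ?c0_norm_ub.
apply/eqP; rewrite eq_le le/=.
have [->|a0] := eqVneq a 0; first by rewrite normr0 mul0r c0_norm_ge0.
by rewrite mulrC -ler_pdivlMr ?normr_gt0// mulrC -normfV
  -{1}(scalerK a0 x) le.
Qed.

Lemma c0_norm_eq0 (x : c0) : c0_norm x = 0 -> x = 0.
Proof.
move=> x0; apply/val_inj/funext => g /=; apply/eqP.
by rewrite -normr_le0 -x0 c0_norm_ub.
Qed.

HB.instance Definition _ :=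
  Lmodule_isNormed.Build R c0 c0_normD c0_normZ c0_norm_eq0.

End C0.

(* Main.v *)
Require Import Defs.
From HB Require Import structures.
From mathcomp Require Import all_boot all_order all_algebra.
From mathcomp Require Import all_classical all_reals all_analysis.
From mathcomp Require Import lra.
Set Implicit Arguments.
Unset Strict Implicit.
Unset Printing Implicit Defensive.
Import Order.TTheory GRing.Theory Num.Theory.
Import numFieldNormedType.Exports.

Local Open Scope classical_set_scope.
Local Open Scope ring_scope.

(** The coordinates of X are bounded in terms of the norm by symmetry,
    so the whole matter is to bound the norm of a vector by its coordinates;
    by convexity this reduces to bounding the sums of distinct basis vectors.
    The embedding and the basis property each contribute one half.

    The embedding bounds the differences s - t of two sums of equally many
    basis vectors, all distinct, uniformly in their number
    ([balanced_sum_bounded]).  Take index sets K_1, ..., K_n, disjoint in L,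
    whose cardinals grow by two power sets at each step, and send a point p of
    K_1 x ... x K_n to f of the (rescaled) sum of the e_(p_i).  Changing one
    coordinate of p moves this value by at most a fixed C.  A map of this kind
    into c_0 always takes values at distance at most 3C at two points which
    differ in every coordinate ([oscillation]), whatever n is: K_n is so much
    larger than K_1 x ... x K_(n-1) that two values y, y' of the last
    coordinate have compatible traces, that is, the functions f(., y) and
    f(., y') agree at every coordinate of c_0 at which both exceed C somewhere
    ([compatible_pair]).  At the remaining coordinates everything is at most
    2C, and at the common ones there is a map on one factor less.  The lower
    control that the embedding gives turns the bound 3C into a bound for
    the norm of the difference of the two sums.

    The basis property turns this into a bound for the sums themselves
    ([sum_basis_bounded]).  The averages of N basis vectors, along N = m 2^k,
    form a Cauchy sequence because their differences are balanced sums divided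
    by N.  All coordinates of the limit vanish, so the limit is 0, since a
    vector of X is determined by its expansion.  Hence the average of m
    vectors has norm at most M / m. *)

(** * Injections into iterated power sets *)

Definition small (n : nat) (A : Type) := exists f : A -> beth n, injective f.

Lemma small_comp n (A B : Type) (g : A -> B) :
  injective g -> small n B -> small n A.
Proof. by move=> gI [f fI]; exists (f \o g); exact: inj_comp. Qed.

Lemma set1_inj (T : Type) : injective (@set1 T).
Proof. by move=> x y xy; have : [set y] x by rewrite -xy. Qed.

Lemma small_succ n (A : Type) : small n A -> small n.+1 A.
Proof.
case=> f fI; exists (fun x => [set f x]).
by apply: inj_comp fI; exact: set1_inj.
Qed.

Lemma small_set n (A : Type) : small n A -> small n.+1 (set A).
Proof.
case=> f fI; exists (image^~ f) => B C /= BC.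
have e (E : set A) x : (f @` E) (f x) = E x by exact: image_inj.
by apply/funext => x; rewrite -e BC e.
Qed.

Lemma small_nat n : small n nat.
Proof.
elim: n => [|n /small_succ//]; by exists id.
Qed.

(** A pair of subsets of a set S is a subset of two disjoint copies of S, and
    these copies fit in S x S, hence in S by induction. *)
Lemma small_beth2 n : small n (beth n * beth n).
Proof.
elim: n => [|n [q qI]]; first by exists pickle; exact: pcan_inj pickleK.
have [c cI] : exists c : bool -> beth n, injective c.
  have [f fI] := small_nat n.
  by exists (fun b : bool => f b) => -[] [] // /fI.
exists (fun A => [set q (c true, x) | x in A.1] `|`
  [set q (c false, x) | x in A.2]).
have mem (A1 A2 : set (beth n)) b x :
    ([set q (c true, y) | y in A1] `|` [set q (c false, y) | y in A2])
      (q (c b, x)) <-> (if b then A1 else A2) x.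
  split=> [[] [y Ay /qI [/cI <- <-]]//|].
  by case: b => Ax; [left | right]; exists x.
move=> [A1 A2] [B1 B2] /= AB; congr pair; apply/seteqP; split=> x.
- by move=> /(mem A1 A2 true); rewrite AB => /mem.
- by move=> /(mem B1 B2 true); rewrite -AB => /mem.
- by move=> /(mem A1 A2 false); rewrite AB => /mem.
- by move=> /(mem B1 B2 false); rewrite -AB => /mem.
Qed.

Lemma small_prod n (A B : Type) : small n A -> small n B -> small n (A * B).
Proof.
move=> [f fI] [g gI].
apply: (small_comp (g := fun p => (f p.1, g p.2)) _ (small_beth2 n)).
by move=> [a b] [a' b'] /= [/fI -> /gI ->].
Qed.

Lemma small_fun n (A B : Type) :
  small n A -> small n.+1 B -> small n.+1 (A -> B).
Proof.
move=> sA [v vI]; have sB : small n (beth n) by exists id.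
pose graph (h : A -> B) := [set p : A * beth n | v (h p.1) p.2].
apply: (small_comp (g := graph) _ (small_set (small_prod sA sB))).
move=> h h' hh'; apply/funext => a; apply: vI; apply/funext => m.
exact: (congr1 (@^~ (a, m)) hh').
Qed.

(** A real is determined by the rationals below it. *)
Lemma small_real n (R : realType) : small n.+1 R.
Proof.
have sQ : small n rat.
  by apply: small_comp (small_nat n); exact: (pcan_inj (@pickleK rat)).
pose cut (x : R) := [set q : rat | ratr q < x].
apply: (small_comp (g := cut) _ (small_set sQ)).
move=> x y xy; wlog lt_xy : x y xy / x < y.
  by move=> H; have [/(H _ _ xy)|/(H _ _ (esym xy))/esym|] := ltgtP x y.
have [q] := rat_in_itvoo lt_xy; rewrite in_itv/= => /andP[xq qy].
have : cut y q by [].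
by rewrite -xy /cut /= ltNge (ltW xq).
Qed.

(** Cantor's theorem. *)
Lemma not_small_succ n : ~ small n (beth n.+1).
Proof.
case=> f fI; pose D := [set x : beth n | exists2 A, f A = x & ~ A x].
have fDN : ~ D (f D) by move=> DfD; case: (DfD) => A /fI ->; apply.
by apply: (fDN); exists D.
Qed.

(** Each y carries the partial function of domain { t y i | i } that is the
    restriction of [W y]; two of these partial functions agree on their common
    domain.  This is the coding of Engelking and Karlowicz: the points of the
    domains are viewed as subsets [u] of [beth n.+1], each domain is separated
    by few elements [D] of [beth n.+1], and y is coded by the separating
    elements, the traces of its points on them, and its values.  There are
    fewer codes than y's.  When y and y' have the same code, a common point is
    listed by both at the same index, because its trace determines the
    index up to repetition, and so it has the same value for both. *)
Lemma compatible_pair n (I V G : Type)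
    (t : beth n.+2 -> I -> G) (W : beth n.+2 -> G -> V) :
    small n I -> small n.+1 V ->
  exists y y', y <> y' /\
    forall i j, t y i = t y' j -> W y (t y i) = W y' (t y i).
Proof.
move=> sI [v vI].
have sY : small n.+2 (beth n.+2) by exists id.
have [c cI] := small_prod sY (small_succ (small_succ sI)).
have [u uP] : {u : G -> beth n.+2 & forall g, (exists p, t p.1 p.2 = g) ->
    exists2 p, u g = c p & t p.1 p.2 = g}.
  apply: (@choice _ _ (fun g A => (exists p, t p.1 p.2 = g) ->
    exists2 p, A = c p & t p.1 p.2 = g)) => g.
  have [[p pg]|no] := pselect (exists p, t p.1 p.2 = g).
    by exists (c p) => _; exists p.
  by exists set0.
have uI y i y' i' : u (t y i) = u (t y' i') -> t y i = t y' i'.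
  have [p -> <-] := uP _ (ex_intro _ (y, i) erefl).
  by have [p' -> <-] := uP _ (ex_intro _ (y', i') erefl); move=> /cI ->.
have [D DP] : {D : beth n.+2 * (I * I) -> beth n.+1 & forall q,
    (u (t q.1 q.2.1) (D q) <-> u (t q.1 q.2.2) (D q)) ->
    t q.1 q.2.1 = t q.1 q.2.2}.
  apply: (@choice _ _ (fun (q : beth n.+2 * (I * I)) k =>
    (u (t q.1 q.2.1) k <-> u (t q.1 q.2.2) k) ->
    t q.1 q.2.1 = t q.1 q.2.2)) => -[y [i j]] /=.
  apply: contrapT => no; have /uI tij : u (t y i) = u (t y j); last first.
    by apply: no; exists set0.
  apply/funext => k; apply/propext; apply: contrapT => nk.
  by apply: no; exists k => /nk.
pose C y := ([set p : I * (I * I) | u (t y p.1) (D (y, p.2))],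
  ((fun q => D (y, q)), (fun i => W y (t y i)))).
have sC : small n.+1 (set (I * (I * I)) * ((I * I -> beth n.+1) * (I -> V))).
  have sII := small_prod sI sI.
  apply: small_prod; first exact/small_set/small_prod.
  apply: small_prod; apply: small_fun => //; first by exists id.
  by exists v.
have [y [y' [ny Cy]]] : exists y y', y <> y' /\ C y = C y'.
  apply: contrapT => no; apply: (@not_small_succ n.+1).
  apply: (small_comp (g := C) _ sC) => y y' Cyy'.
  by apply: contrapT => ny; apply: no; exists y, y'.
exists y, y'; split=> // i j tij; case: Cy => /seteqP[sy sy'] Dy Wy.
have tij' : t y' i = t y' j.
  apply: (DP (y', (i, j))) => /=; rewrite -tij.
  have Dij := congr1 (@^~ (i, j)) Dy; rewrite /= in Dij; rewrite -Dij.
  split=> [H|H]; first by apply: (sy' (i, (i, j))) => /=; rewrite -Dij.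
  by have := sy (i, (i, j)) H; rewrite /= -Dij.
by have := congr1 (@^~ i) Wy => /= ->; rewrite tij' -tij.
Qed.

(** * Lipschitz maps from large boxes to c_0 *)

(** The product of n sets, each two power sets above the product of the
    preceding ones: the gap that [compatible_pair] uses. *)
Fixpoint box (n : nat) : Type :=
  if n is m.+1 then (box m * beth m.*2.+2)%type else unit.

Lemma small_box n : small n.*2 (box n).
Proof.
elim: n => [|n IH]; first by exists (fun=> 0%N) => -[] [].
apply: small_prod; last by exists id.
exact/small_succ/small_succ.
Qed.

Fixpoint neighbours (n : nat) : box n -> box n -> Prop :=
  if n is m.+1 then fun p q =>
    p.1 = q.1 \/ p.2 = q.2 /\ neighbours p.1 q.1
  else fun _ _ => False.

Fixpoint apart (n : nat) : box n -> box n -> Prop :=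
  if n is m.+1 then fun p q => p.2 <> q.2 /\ apart p.1 q.1
  else fun _ _ => True.

Lemma finite_enum (T : Type) (A : set T) (x : T) :
  finite_set A -> exists f : nat -> T, A `<=` range f.
Proof.
move=> /finite_set_countable /pfcard_geP[->|[f]].
  by exists (fun=> x).
by exists f => y /(@surj _ _ _ _ f)[k _ <-]; exists k.
Qed.

(** The last coordinate is fixed by two values y and y' whose traces are
    compatible.  Let T be the set of the g at which both exceed C for some p.
    On T the two traces are equal, so there the claim follows from the
    induction hypothesis for the map truncated to T.  Outside T one trace
    is at most C and the other one at most 2C; no constant accumulates, since
    the two cases concern disjoint sets of g. *)
Lemma oscillation (R : realType) (G : Type) (C : R) n (F : box n -> G -> R) :
  0 <= C ->
  (forall p, finite_set [set g | C < `|F p g|]) ->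
  (forall p q, neighbours p q -> forall g, `|F p g - F q g| <= C) ->
  exists p q, apart p q /\ forall g, `|F p g - F q g| <= C *+ 3.
Proof.
move=> C0; elim: n F => [|n IH] F finF lipF.
  by exists tt, tt; split=> // g; rewrite subrr normr0 mulrn_wge0.
have [t tP] : {t : beth n.*2.+2 * box n -> nat -> option G & forall yp,
    [set Some g | g in [set g | C < `|F (yp.2, yp.1) g|]] `<=` range (t yp)}.
  apply: (@choice _ _ (fun yp f =>
    [set Some g | g in [set g | C < `|F (yp.2, yp.1) g|]] `<=` range f)) => -[y p].
  by apply: finite_enum; [exact: None | exact: finite_image].
pose W y (o : option G) p := if o is Some g then F (p, y) g else 0.
have sI : small n.*2 (box n * nat).
  by apply: small_prod; [exact: small_box | exact: small_nat].
have sV : small n.*2.+1 (box n -> R).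
  by apply: small_fun; [exact: small_box | exact: small_real].
have [y [y' [ny Wyy']]] :=
  @compatible_pair _ (box n * nat) _ _ (fun y i => t (y, i.1) i.2) W sI sV.
pose D y := [set g | exists i, t (y, i.1) i.2 = Some g].
have DP z p g : ~ D z g -> `|F (p, z) g| <= C.
  move=> nD; rewrite leNgt; apply/negP => Fg; apply: nD.
  by have [k _ tk] := tP (z, p) (Some g) (ex_intro2 _ _ g Fg erefl); exists (p, k).
pose T := D y `&` D y'.
have TE g p : T g -> F (p, y) g = F (p, y') g.
  move=> [[i ti] [j tj]]; have := Wyy' i j; rewrite /= ti tj => /(_ erefl).
  by move=> /(congr1 (@^~ p)).
pose F0 p g := if `[< T g >] then F (p, y) g else 0.
have [||p [q [pq Fpq]]] := IH F0.
- move=> p; apply: sub_finite_set (finF (p, y)) => g /=; rewrite /F0.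
  by case: asboolP => // _; rewrite normr0 ltNge C0.
- move=> p q pq g; rewrite /F0; case: asboolP => Tg.
    by apply: lipF => /=; right.
  by rewrite subrr normr0.
exists (p, y), (q, y'); split=> // g.
have [Tg|nTg] := pselect (T g).
  by have := Fpq g; rewrite /F0 asboolT// (TE g q).
have lip r : `|F (r, y) g - F (r, y') g| <= C by apply: lipF; left.
have [/DP yC|/DP yC] : ~ D y g \/ ~ D y' g by exact/not_andP.
- rewrite (_ : _ - _ = F (p, y) g - F (q, y) g + (F (q, y) g - F (q, y') g)).
    rewrite mulrSr mulr2n (le_trans (ler_normD _ _))// lerD//.
    by rewrite (le_trans (ler_normB _ _))// lerD.
  by rewrite addrA subrK.
- rewrite (_ : _ - _ = (F (p, y) g - F (p, y') g) + (F (p, y') g - F (q, y') g)).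
    rewrite mulrS mulr2n (le_trans (ler_normD _ _))// lerD//.
    by rewrite (le_trans (ler_normB _ _))// lerD.
  by rewrite addrA subrK.
Qed.

(** The part that is common to coarse and uniform embeddings: one scale s of
    the source is mapped to a scale C, and points whose images are within 3C
    stay within bounded distance.  A coarse embedding allows any s, a uniform
    embedding a small one. *)
Lemma moduli_control (R : realType) (X Y : normedModType R) (f : X -> Y) :
  coarse_embedding f \/ uniform_embedding f ->
  exists s C t : R, [/\ 0 < s, 0 < C,
    forall x y, `|x - y| <= s -> `|f x - f y| <= C
    & forall x y, `|f x - f y| <= C *+ 3 -> `|x - y| <= t].
Proof.
have expP x y s C : (expansion_modulus f s <= C%:E)%E -> `|x - y| <= s ->
    `|f x - f y| <= C.
  move=> sC xy; rewrite -lee_fin (le_trans _ sC)//.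
  by apply: ereal_sup_ubound; exists (x, y).
have comP x y t C : (C%:E < compression_modulus f t)%E -> `|f x - f y| <= C ->
    `|x - y| <= t.
  move=> Ct fC; rewrite leNgt; apply/negP => /ltW txy.
  have inf_le : (compression_modulus f t <= `|f x - f y|%:E)%E.
    by apply: ereal_inf_lbound; exists (x, y).
  by have := lt_le_trans Ct inf_le; rewrite lte_fin ltNge fC.
case=> [[fin inf]|[exp0 com]].
- pose C := `|fine (expansion_modulus f 1)| + 1.
  have C0 : 0 < C by rewrite ltr_wpDl.
  have [t tP] : exists t, ((C *+ 3)%:E < compression_modulus f t)%E.
    move/cvgeyPgt : inf => /(_ (C *+ 3)) H.
    by have [t] := filter_ex H; exists t.
  exists 1, C, t; split=> // x y; last exact: comP.
  apply: expP; have := fin 1 ltr01; rewrite /C.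
  case: (expansion_modulus f 1) => [r| |] //= _; last by rewrite leNye.
  by rewrite lee_fin (le_trans (ler_norm r))// lerDl.
- have [C C0 CP] : exists2 D : R, 0 < D &
      ((D *+ 3)%:E < compression_modulus f 1)%E.
    have := com 1 ltr01; case: (compression_modulus f 1) => [r| |] //.
      rewrite lte_fin => r0; exists (r / 4); first by rewrite divr_gt0.
      by rewrite lte_fin; lra.
    by move=> _; exists 1 => //; rewrite ltry.
  have [s s0 sC] : exists2 s : R, 0 < s & (expansion_modulus f s <= C%:E)%E.
    have : \forall t \near 0^'+, (expansion_modulus f t < C%:E)%E.
      have C0e : (0 < C%:E)%E by rewrite lte_fin.
      exact: (exp0 _ (open_ereal_lt' C0e)).
    move=> H; near (0:R)^'+ => s.
    exists s => //; apply: ltW; near: s; exact: H.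
  exists s, C, 1; split=> // x y; [exact: expP | exact: comP].
Unshelve. all: by end_near.
Qed.

(** * Balanced sums of a symmetric family *)

Lemma beth_omega_inj (T : Type) : ([set: beth_omega] #<= [set: T])%card ->
  exists h : beth_omega -> T, injective h.
Proof.
move=> /card_leP[h]; exists (fun b => val (h (to_setT b))) => x y /val_inj xy.
have /(congr1 val) : to_setT x = to_setT y.
  by apply: (@inj _ _ _ h) => //; rewrite inE.
by [].
Qed.

Section SymmetricFamily.
Context (R : realType) (X : normedModType R) (d : Order.disp_t)
  (L : orderType d) (e : L -> X).
Context (e_symm : symmetric_family e).

(** Indexing by two sequences makes symmetry a statement about replacing one
    duplicate-free sequence by another. *)
Definition lincomb (c : seq R) (s : seq L) : X :=
  \sum_(p <- zip c s) p.1 *: e p.2.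

Lemma lincomb_map (a : L -> R) s :
  lincomb (map a s) s = \sum_(i <- s) a i *: e i.
Proof.
by rewrite /lincomb; elim: s => [|i s IH] /=; rewrite ?big_nil// !big_cons IH.
Qed.

Lemma norm_lincomb c s s' : uniq s -> uniq s' -> size c = size s ->
  size s' = size s -> `|lincomb c s| = `|lincomb c s'|.
Proof.
move=> us us' cs ss'.
case: s => [|x s] in us cs ss' *.
  by move: ss' => /size0nil ->.
have E u : size u = size (x :: s) ->
    lincomb c u = \sum_(i < size (x :: s)) c`_i *: e (nth x u i).
  move=> su; rewrite /lincomb (big_nth (0, x)) big_mkord size_zip cs su minnn.
  by apply: eq_bigr => i _; rewrite nth_zip ?cs.
rewrite !E//; apply: e_symm => i j /eqP.
  by rewrite nth_uniq// => /eqP/val_inj.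
by rewrite nth_uniq// ?ss'// => /eqP/val_inj.
Qed.

Lemma sum_lincomb1 u : \sum_(i <- u) e i = lincomb (nseq (size u) 1) u.
Proof.
rewrite /lincomb; elim: u => [|i u IH] /=; first by rewrite !big_nil.
by rewrite !big_cons IH/= scale1r.
Qed.

Lemma norm_sum_eq s s' : uniq s -> uniq s' -> size s' = size s ->
  `|\sum_(i <- s) e i| = `|\sum_(i <- s') e i|.
Proof.
move=> us us' ss'; rewrite !sum_lincomb1 ss'.
by apply: norm_lincomb => //; rewrite size_nseq.
Qed.

Lemma norm_sumB_eq s t s' t' : uniq (s ++ t) -> uniq (s' ++ t') ->
  size s' = size s -> size t' = size t ->
  `|\sum_(i <- s) e i - \sum_(i <- t) e i| =
  `|\sum_(i <- s') e i - \sum_(i <- t') e i|.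
Proof.
move=> us us' ss' tt'.
have sumB u v : \sum_(i <- u) e i - \sum_(i <- v) e i =
    lincomb (nseq (size u) 1 ++ nseq (size v) (-1)) (u ++ v).
  rewrite /lincomb zip_cat ?size_nseq// big_cat/= sum_lincomb1; congr +%R.
  elim: v => [|i v IH] /=; first by rewrite !big_nil oppr0.
  by rewrite !big_cons opprD IH /= scaleN1r.
rewrite !sumB ss' tt'; apply: norm_lincomb => //.
  by rewrite !size_cat !size_nseq.
by rewrite !size_cat ss' tt'.
Qed.

Section Vertices.
Context (h : beth_omega -> L) (hI : injective h).

(** The factors of a box sit at different levels of the disjoint union
    [beth_omega], so the entries of a vertex are distinct. *)
Fixpoint vertex (n : nat) : box n -> seq L :=
  if n is m.+1 then
    fun p => h (existT beth m.*2.+2 p.2) :: vertex p.1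
  else fun=> [::].

Lemma size_vertex n (p : box n) : size (vertex p) = n.
Proof. by elim: n p => [|n IH] //= p; rewrite IH. Qed.

Lemma vertex_level n (p : box n) x : x \in vertex p ->
  exists2 b, x = h b & (projT1 b <= n.*2)%N.
Proof.
elim: n p => [|n IH] //= p; rewrite inE => /predU1P[->|/IH[b -> bn]].
  by eexists; first by reflexivity.
by exists b => //; rewrite (leq_trans bn)// doubleS -addn2 leq_addr.
Qed.

Lemma vertex_fresh n (p : box n) b : h (existT beth n.*2.+2 b) \notin vertex p.
Proof.
by apply/negP => /vertex_level[c /hI <-] /=; rewrite ltnNge leqnSn.
Qed.

Lemma apart_uniq n (p q : box n) : apart p q -> uniq (vertex p ++ vertex q).
Proof.
elim: n p q => [|n IH] //= p q [pq /IH upq].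
rewrite mem_cat inE !negb_or !vertex_fresh/= andbT.
rewrite -(cat1s _ (vertex q.1)) uniq_catCA/= mem_cat negb_or !vertex_fresh upq/= andbT.
apply/eqP => /hI /(Eqdep_dec.inj_pair2_eq_dec _ PeanoNat.Nat.eq_dec beth).
exact: pq.
Qed.

Lemma neighbours_vertex (E : R) n (p q : box n) : (forall i, `|e i| <= E) ->
  neighbours p q ->
  `|\sum_(i <- vertex p) e i - \sum_(i <- vertex q) e i| <= E *+ 2.
Proof.
move=> eE; elim: n p q => [|n IH] //= p q.
rewrite !big_cons opprD addrACA => -[->|[-> /IH]].
  rewrite subrr addr0 mulr2n (le_trans (ler_normB _ _))//.
  by rewrite lerD.
by rewrite subrr add0r.
Qed.

End Vertices.

(** The vertices of two points provided by [oscillation] give one balanced sum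
    of each length that is bounded; by symmetry all the others of that length
    have the same norm. *)
Lemma balanced_sum_bounded (G : Type) (f : X -> c0 R G) :
  ([set: beth_omega] #<= [set: L])%card ->
  coarse_embedding f \/ uniform_embedding f ->
  exists M, forall s t, uniq (s ++ t) -> size s = size t ->
    `|\sum_(i <- s) e i - \sum_(i <- t) e i| <= M.
Proof.
move=> /beth_omega_inj[h hI] /moduli_control[s [C [t [s0 C0 lipf cof]]]].
have [E E0 eE] : exists2 E, 0 < E & forall i, `|e i| <= E.
  exists (`|e (h (existT beth 0%N 0%N))| + 1); first by rewrite ltr_wpDl.
  move=> i; have := @norm_sum_eq [:: i] [:: h (existT beth 0%N 0%N)].
  by rewrite !big_seq1 => -> //; rewrite lerDl.
(* neighbouring vertices are at distance at most 2E: scale this to s *)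
pose r := s / (E *+ 2).
have r0 : 0 < r by rewrite divr_gt0// mulrn_wgt0.
exists (t / r) => u v uv suv; set n := size v in suv.
pose F (p : box n) := f (r *: \sum_(i <- vertex h p) e i) : G -> R.
have fE x y g : `|f x g - f y g| <= `|f x - f y|.
  exact: c0_norm_ub (f x - f y) g.
have [||p [q [pq Fpq]]] := @oscillation R G C n F (ltW C0).
- by move=> p; have /asboolP := c0P (f (r *: \sum_(i <- vertex h p) e i)); exact.
- move=> p q pq g; apply: le_trans (fE _ _ g) _; apply: lipf.
  rewrite -scalerBr normrZ gtr0_norm// -ler_pdivlMl// invf_div mulfVK ?gt_eqF//.
  exact: neighbours_vertex eE pq.
rewrite (@norm_sumB_eq _ _ (vertex h p) (vertex h q)) ?size_vertex//.
  rewrite ler_pdivlMr// mulrC -[r in r * _]gtr0_norm// -normrZ scalerBr.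
  apply: cof; apply: c0_norm_le => [|g]; last exact: Fpq.
  by rewrite mulrn_wge0// ltW.
exact: apart_uniq.
Qed.

End SymmetricFamily.

(** * Transfinite sums *)

Section TransfiniteSums.
Context (d : Order.disp_t) (L : orderType d).

Lemma olt_trans (b a c : option L) : olt a b -> olt b c -> olt a c.
Proof. by case: a b c => [a|] [b|] [c|] //=; exact: lt_trans. Qed.

Lemma olt_irr (a : option L) : olt a a = false.
Proof. by case: a => [a|] //=; rewrite ltxx. Qed.

Lemma olt_total (a b : option L) : [\/ a = b, olt a b | olt b a].
Proof.
case: a b => [a|] [b|] /=; [|by constructor|by constructor|by constructor].
have [ab|ba|->] := ltgtP a b; [exact: Or32|exact: Or33|exact: Or31].
Qed.

Lemma olt_ind (P : option L -> Prop) :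
  wochoice.well_order (<=%O : rel L) ->
  (forall a, (forall b, olt b a -> P b) -> P a) -> forall a, P a.
Proof.
move=> wo IH.
have PS x : P (Some x).
  apply: contrapT => nPx.
  have [|z [[]]] := wo [pred y | `[< ~ P (Some y) >]].
    by exists x; apply/asboolP.
  rewrite inE => nPz zmin _.
  apply: nPz; apply: IH => -[y|//] /= yz.
  apply: contrapT => nPy.
  have := zmin y; rewrite inE => /(_ nPy).
  by rewrite leNgt yz.
by move=> [x|//]; apply: IH => -[].
Qed.

Lemma olt_cases (a : option L) :
  [\/ ofirst a, exists b, osucc (Some b) a | olimit a].
Proof.
have [fa|nfa] := pselect (ofirst a); first exact: Or31.
have [b0 b0a] : exists b, olt b a.
  by apply: contrapT => no; apply: nfa => b; apply/negP => ba; apply: no; exists b.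
have [lim|nlim] := pselect (olimit a); first exact: Or33.
apply: Or32; apply: contrapT => nsucc; apply: nlim; split; first by exists b0.
move=> b ba; apply: contrapT => no.
case: b ba no => [b|//] ba no; apply: nsucc; exists b; split=> // c.
by apply/negP => bca; apply: no; exists c.
Qed.

Lemma obelow_proper (a : option L) : olimit a -> ProperFilter (obelow a).
Proof.
move=> [[b ba] lim]; apply: filter_from_proper.
  apply: filter_from_filter; first by exists b.
  move=> i j ia ja; have [->|ij|ji] := olt_total i j.
  - by exists j => // c.
  - exists j => // c /= /andP[jc ca]; split=> /=; rewrite ?jc ?ca//=.
    by rewrite (olt_trans ij jc).
  - exists i => // c /= /andP[ic ca]; split=> /=; rewrite ?ic ?ca//=.
    by rewrite (olt_trans ji ic).
by move=> i ia; exact: lim.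
Qed.

Context (R : realType) (X : normedModType R).
Context (L_wo : wochoice.well_order (<=%O : rel L)).

(** By transfinite induction, every partial sum is a limit of finite sums of
    terms of the series itself; at a limit ordinal an earlier partial sum is
    used, taken late enough to involve the given index g.  With g in the finite
    sum, bounds for finite coordinate functionals pass to transfinite ones. *)
Lemma tsum_approx (u : L -> X) (x : X) (g : L) (eps : R) :
  is_tsum u x -> 0 < eps ->
  exists s : seq L,
    [/\ uniq s, g \in s & `|x - \sum_(i <- s) u i| < eps].
Proof.
move=> [S [S0 Ssucc Slim <-]] eps0.
(* the sum at None, generalized to the partial sum at any ordinal *)
suff [s [us _ gs Ss]] : exists s : seq L, [/\ uniq s,
    forall i, i \in s -> olt (Some i) None,
    olt (Some g) None -> g \in s & `|S None - \sum_(i <- s) u i| < eps].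
  by exists s; split=> //; exact: gs.
move: (None) eps eps0; apply: (olt_ind L_wo) => a IH eps eps0.
have [fa|[b [ba nba]]|lima] := olt_cases a.
- exists [::]; split=> //; first by rewrite (negbTE (fa _)).
  by rewrite (S0 _ fa) big_nil subrr normr0.
- have [s [us sb gs Ss]] := IH _ ba _ eps0; exists (b :: s); split.
  + rewrite /= us andbT; apply/negP => /sb; by rewrite olt_irr.
  + move=> i; rewrite inE => /predU1P[->//|/sb ib]; exact: olt_trans ib ba.
  + move=> ga; rewrite inE; have [[gb]|gb|bg] := olt_total (Some g) (Some b).
    * by rewrite gb eqxx.
    * by rewrite gs ?orbT.
    * by have := nba (Some g); rewrite bg ga.
  + by rewrite (Ssucc b a)// big_cons (addrC (S _)) opprD addrACA subrr add0r.
- have PF := obelow_proper lima.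
  have eps2 : 0 < eps / 2 by rewrite divr_gt0.
  have [b ba bP] : exists2 b, olt b a & olt (Some g) a -> olt (Some g) b.
    have [ga|nga] := boolP (olt (Some g) a).
      by case: lima => _ /(_ _ ga)[c /andP[gc ca]]; exists c.
    by case: lima => -[c ca] _; exists c.
  have near_b : \forall c \near obelow a, olt b c && olt c a by exists b.
  have := Slim _ lima => /cvgrPdist_lt /(_ _ eps2) near_eps.
  have [c [/andP[bc ca] Sc]] := filter_ex (filterI near_b near_eps).
  have [s [us sc gs Ss]] := IH _ ca _ eps2; exists s; split=> //.
  + by move=> i /sc ic; exact: olt_trans ic ca.
  + by move=> /bP gb; apply: gs; exact: olt_trans gb bc.
  + rewrite -(subrK (S c) (S a)) -addrA (splitr eps).
    by rewrite (le_lt_trans (ler_normD _ _))// ltrD.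
Qed.

Lemma tsum_linear (k : R) (u v : L -> X) (x y : X) :
  is_tsum u x -> is_tsum v y -> is_tsum (fun i => k *: u i + v i) (k *: x + y).
Proof.
move=> [S [S0 Ss Sl Sx]] [T [T0 Ts Tl Ty]].
exists (fun a => k *: S a + T a); split=> [a fa|b a sa|a la|].
- by rewrite S0// T0// scaler0 addr0.
- by rewrite (Ss b a)// (Ts b a)// scalerDr addrACA.
- have PF := obelow_proper la.
  by apply: cvgD; [apply: cvgZr; exact: Sl | exact: Tl].
- by rewrite Sx Ty.
Qed.

(** The partial sums jump from 0 to [u g] right after the index g. *)
Lemma tsum_single (g : L) (u : L -> X) :
  is_tsum (fun i => if i == g then u i else 0) (u g).
Proof.
exists (fun a => if olt (Some g) a then u g else 0); split=> //.
- by move=> a /(_ (Some g)) /negbTE ->.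
- move=> b a [ba nba]; have [bg|bg] := eqVneq b g.
    by rewrite -bg ba olt_irr add0r.
  rewrite addr0; congr (if _ then _ else _).
  have [[gb]|gb|lt_bg] := olt_total (Some g) (Some b).
  + by rewrite gb eqxx in bg.
  + by rewrite gb (olt_trans gb ba).
  + apply/idP/idP => [ga|gb]; first by have := nba (Some g); rewrite lt_bg ga.
    exact: olt_trans gb ba.
- move=> a la; have PF := obelow_proper la.
  have [ga|nga] := boolP (olt (Some g) a).
    apply: cvg_near_cst; exists (Some g) => // c /andP[gc _].
    by rewrite gc.
  apply: cvg_near_cst; case: la => -[b ba] _; exists b => // c /andP[bc ca].
  by case: ifPn => // gc; rewrite (olt_trans gc ca) in nga.
Qed.

End TransfiniteSums.

(** * Symmetric bases *)

Lemma cauchy_rate_cvg (R : realType) (X : completeNormedModType R)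
    (y : nat -> X) (C : R) :
  (forall k l, (k <= l)%N -> `|y k - y l| <= C / k.+1%:R) ->
  exists z, forall eps, 0 < eps -> exists k0, forall k, (k0 <= k)%N ->
    `|z - y k| < eps /\ k.+1%:R^-1 < eps.
Proof.
move=> yC.
have rate (B eps : R) : 0 < eps -> exists k0, forall k, (k0 <= k)%N ->
    B / k.+1%:R < eps.
  move=> eps0; exists (Num.truncn (`|B| / eps)).+1 => k kk0.
  rewrite ltr_pdivrMr// (le_lt_trans (ler_norm _))// mulrC -ltr_pdivrMr//.
  apply: lt_trans (truncnS_gt _) _; rewrite ltr_nat ltnS.
  exact: kk0.
have /cauchy_cvgP ycvg : cauchy (y @ \oo).
  apply: cauchy_exP => eps eps0; have [k0 k0P] := rate C _ eps0.
  exists (y k0); exists k0 => // k /= k0k.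
  by rewrite -ball_normE /= (le_lt_trans (yC _ _ k0k))// k0P.
exists (lim (y @ \oo)) => eps eps0.
have [k1 k1P] := rate 1 _ eps0.
have /cvgrPdist_lt /(_ _ eps0)[k0 _ k0P] := ycvg.
exists (maxn k0 k1) => k; rewrite geq_max => /andP[k0k k1k]; split.
  exact: k0P.
by have := k1P _ k1k; rewrite mul1r.
Qed.

Section SymmetricBasis.
Context (R : realType) (X : completeNormedModType R) (d : Order.disp_t)
  (L : orderType d) (e : L -> X).
Context (L_wo : wochoice.well_order (<=%O : rel L))
  (e_symm : symmetric_family e).
Context (idx : nat -> L) (coef : X -> L -> R).
Context (idx_inj : injective idx)
  (coefP : forall x, is_tsum (fun g => coef x g *: e g) x)
  (coef_uniq : forall x a, is_tsum (fun g => a g *: e g) x -> coef x = a).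

Lemma coef_linear k x y g : coef (k *: x + y) g = k * coef x g + coef y g.
Proof.
rewrite (@coef_uniq _ (fun g => k * coef x g + coef y g))//.
rewrite (_ : (fun g => _) = (fun g => k *: (coef x g *: e g) + coef y g *: e g)).
  exact: tsum_linear.
by apply/funext => i; rewrite scalerDl scalerA.
Qed.

Lemma coef0 g : coef 0 g = 0.
Proof.
have := coef_linear 1 0 0 g; rewrite scale1r addr0 mul1r => /eqP.
by rewrite -subr_eq subrr eq_sym => /eqP.
Qed.

Lemma coefB x y g : coef (x - y) g = coef x g - coef y g.
Proof. by rewrite addrC -scaleN1r coef_linear mulN1r addrC. Qed.

Lemma coef_basis h g : coef (e h) g = (g == h)%:R.
Proof.
rewrite (@coef_uniq _ (fun g => (g == h)%:R))//.
rewrite (_ : (fun g => _) = (fun g => if g == h then e g else 0)).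
  exact: tsum_single.
by apply/funext => i; case: eqVneq; rewrite (scale1r, scale0r).
Qed.

Lemma coef_sum (s : seq L) (a : L -> R) g : uniq s ->
  coef (\sum_(i <- s) a i *: e i) g = if g \in s then a g else 0.
Proof.
elim: s => [|i s IH] /=; first by rewrite big_nil coef0.
move=> /andP[is_ /IH sE]; rewrite big_cons coef_linear coef_basis sE inE.
have [->|gi] := eqVneq g i; first by rewrite (negbTE is_) mulr1 addr0.
by rewrite mulr0 add0r.
Qed.

Lemma fresh (s : seq L) : exists g, g \notin s.
Proof.
apply: contrapT => no.
have : (size (map idx (iota 0 (size s).+1)) <= size s)%N.
  apply: uniq_leq_size; first by rewrite map_inj_uniq// iota_uniq.
  by move=> g _; apply: contrapT => /negP gs; apply: no; exists g.
by rewrite size_map size_iota ltnn.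
Qed.

(** By symmetry, the common distance of any two basis vectors. *)
Definition gap := `|e (idx 0%N) - e (idx 1%N)|.

Lemma gap_gt0 : 0 < gap.
Proof.
rewrite /gap normr_gt0 subr_eq0; apply/eqP => /(congr1 (coef^~ (idx 0%N))).
rewrite !coef_basis eqxx (inj_eq idx_inj) /= => /eqP.
by rewrite oner_eq0.
Qed.

Lemma gapE i j : i != j -> `|e i - e j| = gap.
Proof.
move=> ij; have := norm_sumB_eq e_symm (s := [:: i]) (t := [:: j])
  (s' := [:: idx 0%N]) (t' := [:: idx 1%N]).
by rewrite !big_seq1; apply=> //=; rewrite inE ?ij// (inj_eq idx_inj).
Qed.

(** Exchanging the index g for one outside the sum does not change the norm,
    and the difference of the two vectors is [a g] times a difference of two
    basis vectors. *)
Lemma finite_coef_bound (s : seq L) (a : L -> R) g : uniq s -> g \in s ->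
  `|a g| * gap <= `|\sum_(i <- s) a i *: e i| *+ 2.
Proof.
move=> us gs; have [h hs] := fresh s.
pose phi i := if i == g then h else i.
have us' : uniq (map phi s).
  rewrite map_inj_in_uniq// => i j i_s js; rewrite /phi.
  case: eqVneq => [->|_]; case: eqVneq => [->|_] // E.
    by rewrite E js in hs.
  by rewrite -E i_s in hs.
have E : `|\sum_(i <- s) a i *: e (phi i)| = `|\sum_(i <- s) a i *: e i|.
  have -> : \sum_(i <- s) a i *: e (phi i) = lincomb e (map a s) (map phi s).
    by rewrite /lincomb zip_map big_map.
  by rewrite -lincomb_map; apply: norm_lincomb; rewrite // ?size_map.
have gh : g != h by apply: contra hs => /eqP <-.
rewrite -(gapE gh) -normrZ mulr2n -{2}E.
apply: le_trans (ler_normB _ _).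
rewrite -sumrB (bigD1_seq g)//= big1 ?addr0 => [|i ig].
  by rewrite /phi eqxx -scalerBr.
by rewrite /phi (negbTE ig) subrr.
Qed.

Lemma coef_bound x g : `|coef x g| * gap <= `|x| *+ 2.
Proof.
apply/ler_addgt0Pr => eps eps0.
have [|s [us gs xs]] := tsum_approx L_wo g (coefP x) (_ : 0 < eps / 2).
  by rewrite divr_gt0.
apply: le_trans (finite_coef_bound _ us gs) _.
rewrite (splitr eps) -mulr2n -mulrnDl ler_wMn2r//.
set S := \sum_(i <- s) _ in xs *.
apply: le_trans (_ : `|x| + `|S - x| <= _).
  by rewrite -{1}(subrK x S) addrC ler_normD.
by rewrite lerD2l distrC ltW.
Qed.

(** This is where a basis differs from a family with bounded coordinates, such
    as the completion of the finitely supported families for the maximum of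
    the sup norm and the absolute value of the sum: there the averages of the
    unit vectors have a nonzero limit, whose coordinates all vanish. *)
Lemma coef_eq0 x : (forall g, coef x g = 0) -> x = 0.
Proof.
move=> x0; apply/eqP; rewrite -normr_le0; apply/ler_addgt0Pr => eps eps0.
have [s [_ _]] := tsum_approx L_wo (idx 0%N) (coefP x) eps0.
by rewrite big1 ?subr0 ?add0r => [/ltW//|i _]; rewrite x0 scale0r.
Qed.

Section Bounded.
Context (M : R) (balanced : forall s t, uniq (s ++ t) -> size s = size t ->
    `|\sum_(i <- s) e i - \sum_(i <- t) e i| <= M).

Definition average (n : nat) : X := n%:R^-1 *: \sum_(0 <= i < n) e (idx i).

Lemma balanced_bound_ge0 : 0 <= M.
Proof. by have := @balanced [::] [::]; rewrite big_nil subrr normr0; exact. Qed.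

(** Over the common denominator 2n, the difference is the balanced sum of the
    first n vectors and the next n. *)
Lemma average_double n : (0 < n)%N ->
  `|average n - average n.*2| <= M / n.*2%:R.
Proof.
move=> n0.
have n20 : (0 < n.*2)%N by rewrite double_gt0.
have -> : average n = n.*2%:R^-1 *: ((\sum_(0 <= i < n) e (idx i)) *+ 2).
  rewrite /average -muln2 natrM invfM -scalerA; congr (_ *: _).
  by rewrite -(scaler_nat 2 (\sum_(_ <= _ < _) _)) scalerA mulVf ?scale1r// pnatr_eq0.
rewrite /average -scalerBr normrZ ger0_norm ?invr_ge0// mulrC ler_wpM2r ?invr_ge0//.
rewrite (@big_cat_nat _ _ _ n 0%N n.*2)//=; last by rewrite -addnn leq_addr.
rewrite mulr2n opprD addrACA subrr add0r.
have E u v : \sum_(u <= i < v) e (idx i) = \sum_(i <- map idx (index_iota u v)) e i.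
  by rewrite big_map.
rewrite !E; apply: balanced.
  by rewrite -map_cat map_inj_uniq// /index_iota subn0 -addnn addnK -iotaD iota_uniq.
by rewrite !size_map !size_iota -addnn addnK subn0.
Qed.

Lemma average_dyadic m k j : (0 < m)%N ->
  `|average (m * 2 ^ k) - average (m * 2 ^ (k + j))| <=
  M / m%:R * (2^-1 ^+ k - 2^-1 ^+ (k + j)).
Proof.
move=> m0; elim: j => [|j IH]; first by rewrite addn0 !subrr normr0 mulr0.
set N := (m * 2 ^ (k + j))%N in IH *.
have N0 : (0 < N)%N by rewrite muln_gt0 m0 expn_gt0.
have -> : (m * 2 ^ (k + j.+1))%N = N.*2.
  by rewrite /N addnS expnSr mulnA muln2.
rewrite -(subrK (average N) (average _)) -addrA.
apply: le_trans (ler_normD _ _) (le_trans (lerD IH (average_double N0)) _).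
rewrite /N -muln2 !natrM natrX !invfM -exprVn addnS [in leRHS]exprS !mulrA.
lra.
Qed.

(** The averages over m 2^k vectors converge to a vector whose coordinates
    vanish, hence to 0, while the first of them, for k = 0, stays within M / m
    of all the others. *)
Lemma sum_basis_bounded (s : seq L) : uniq s -> `|\sum_(i <- s) e i| <= M.
Proof.
move=> us; case: (posnP (size s)) => [/size0nil ->|m0].
  by rewrite big_nil normr0 balanced_bound_ge0.
set m := size s in m0.
have mR : 0 < m%:R :> R by rewrite ltr0n.
have Mm : 0 <= M / m%:R by rewrite divr_ge0 ?balanced_bound_ge0.
have half k : 2^-1 ^+ k <= k.+1%:R^-1 :> R.
  rewrite exprVn lef_pV2 ?posrE ?exprn_gt0// -natrX ler_nat.
  exact: ltn_expl.
pose y k := average (m * 2 ^ k).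
have yM k l : (k <= l)%N -> `|y k - y l| <= M / m%:R / k.+1%:R.
  move=> kl; have := average_dyadic k (l - k) m0; rewrite subnKC// => /le_trans.
  by apply; rewrite ler_wpM2l// (le_trans _ (half k))// gerBl exprn_ge0.
have [z zP] := cauchy_rate_cvg yM.
have z0 : z = 0.
  apply: coef_eq0 => g; apply/eqP; rewrite -normr_le0 -(pmulr_lle0 _ gap_gt0).
  apply/ler_addgt0Pr => eps eps0; rewrite add0r.
  have [|k0 /(_ _ (leqnn _))[zk kk]] := zP (eps / (gap + 2)).
    by rewrite divr_gt0// ltr_wpDl// ltW// gap_gt0.
  have yk : `|coef (y k0) g| <= k0.+1%:R^-1.
    rewrite /y /average (_ : \sum_(_ <= i < _) _ =
       \sum_(i <- map idx (index_iota 0 (m * 2 ^ k0))) 1 *: e i); last first.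
      by rewrite big_map; apply: eq_bigr => i _; rewrite scale1r.
    rewrite -[_ *: _]addr0 coef_linear coef0 addr0 coef_sum; last first.
      by rewrite map_inj_uniq// iota_uniq.
    apply: (@le_trans _ _ ((m * 2 ^ k0)%:R^-1)).
      rewrite normrM ger0_norm ?invr_ge0// ler_piMr ?invr_ge0//.
      by case: ifP; rewrite ?normr1// normr0.
    rewrite lef_pV2 ?posrE ?ltr0n ?muln_gt0 ?m0 ?expn_gt0// ler_nat.
    by rewrite (leq_trans (ltn_expl _ (ltnSn 1)))// leq_pmull.
  rewrite -(subrK (y k0) z) -[coef _ _]mul1r.
  rewrite -{1}[z - _]scale1r mul1r coef_linear mul1r.
  apply: le_trans (_ : (`|coef (z - y k0) g| + `|coef (y k0) g|) * gap <= _).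
    by rewrite ler_wpM2r ?ler_normD// ltW// gap_gt0.
  rewrite mulrDl (le_trans (lerD (coef_bound _ _) (lexx _)))//.
  rewrite (le_trans (lerD (ler_wMn2r 2 (ltW zk))
    (ler_wpM2r (ltW gap_gt0) (le_trans yk (ltW kk)))))//.
  rewrite -[X in X + _]mulr_natr -mulrDr (addrC _ gap) mulfVK// gt_eqF//.
  by rewrite ltr_wpDl// ltW// gap_gt0.
have y0 : `|y 0%N| <= M / m%:R.
  apply/ler_addgt0Pr => eps eps0; have [k /(_ _ (leqnn _))[zk _]] := zP _ eps0.
  rewrite -(subrK (y k) (y 0%N)) (le_trans (ler_normD _ _))// lerD//.
    by have := yM 0%N k (leq0n _); rewrite invr1 mulr1.
  by move: zk; rewrite z0 sub0r normrN => /ltW.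
have -> : `|\sum_(i <- s) e i| = `|\sum_(i <- map idx (index_iota 0 m)) e i|.
  apply: norm_sum_eq => //; first by rewrite map_inj_uniq// iota_uniq.
  by rewrite size_map size_iota subn0.
rewrite big_map; move: y0; rewrite /y expn0 muln1 /average normrZ.
by rewrite ger0_norm ?invr_ge0// mulrC ler_pM2r// invr_gt0.
Qed.

(** A convex function on a cube is maximal at a vertex; w collects the
    coordinates which are already at a vertex. *)
Lemma norm_cube_le (s : seq L) (w : X) (B : R) :
  (forall t, subseq t s -> `|w + \sum_(i <- t) e i| <= B) ->
  forall a : L -> R, (forall i, 0 <= a i <= 1) ->
    `|w + \sum_(i <- s) a i *: e i| <= B.
Proof.
elim: s w => [|j s IH] w wB a a01.
  by rewrite big_nil; have := wB [::] erefl; rewrite big_nil.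
have B0 : `|w + \sum_(i <- s) a i *: e i| <= B.
  apply: IH => // t ts; apply: wB; exact: subseq_trans ts (subseq_cons _ _).
have B1 : `|w + e j + \sum_(i <- s) a i *: e i| <= B.
  apply: IH => // t ts; have := wB (j :: t); rewrite big_cons addrA; apply.
  by rewrite /= eqxx.
rewrite big_cons; set S := \sum_(i <- s) _ in B0 B1 *.
have /andP[aj0 aj1] := a01 j.
have -> : w + (a j *: e j + S) = (1 - a j) *: (w + S) + a j *: (w + e j + S).
  rewrite (addrAC w) [a j *: (_ + e j)]scalerDr [RHS]addrA -scalerDl subrK.
  by rewrite scale1r addrA addrAC.
apply: le_trans (ler_normD _ _) _; rewrite !normrZ ger0_norm ?subr_ge0//.
rewrite (ger0_norm aj0) (le_trans (lerD (ler_wpM2l _ B0) (ler_wpM2l aj0 B1)))//.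
  by rewrite subr_ge0.
by rewrite -mulrDl subrK mul1r.
Qed.

Lemma norm_sum_le (s : seq L) (a : L -> R) (B : R) : uniq s -> 0 <= B ->
  (forall i, `|a i| <= B) -> `|\sum_(i <- s) a i *: e i| <= B * (M *+ 2).
Proof.
move=> us; rewrite le_eqVlt => /predU1P[<- a0|B0 aB].
  rewrite mul0r big1 ?normr0// => i _.
  by have := a0 i; rewrite normr_le0 => /eqP ->; rewrite scale0r.
have cube b : (forall i, 0 <= b i <= B) -> `|\sum_(i <- s) b i *: e i| <= B * M.
  move=> b0B; rewrite (_ : \sum_(i <- s) _ = B *: (0 + \sum_(i <- s) (b i / B) *: e i)).
    rewrite normrZ gtr0_norm// ler_pM2l//; apply: norm_cube_le => //.
      by move=> t ts; rewrite add0r sum_basis_bounded// (subseq_uniq ts).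
    by move=> i; rewrite ler_pdivlMr// ler_pdivrMr// mul0r mul1r.
  rewrite add0r scaler_sumr; apply: eq_bigr => i _.
  by rewrite scalerA mulrCA divff ?mulr1// gt_eqF.
rewrite (_ : \sum_(i <- s) _ = \sum_(i <- s) Num.max (a i) 0 *: e i -
    \sum_(i <- s) Num.max (- a i) 0 *: e i).
  rewrite mulrnAr mulr2n (le_trans (ler_normB _ _))// lerD// cube// => i.
    by rewrite le_max lexx orbT ge_max (ltW B0) (le_trans (ler_norm _)).
  rewrite le_max lexx orbT ge_max (ltW B0) (le_trans (ler_norm _))//.
  by rewrite normrN.
rewrite -sumrB; apply: eq_bigr => i _; rewrite -scalerBl; congr (_ *: _).
have /orP[ai|ai] := le_total 0 (a i).
  by rewrite (max_idPl ai) (max_idPr _) ?oppr_le0// subr0.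
by rewrite (max_idPr ai) (max_idPl _) ?oppr_ge0// sub0r opprK.
Qed.

Lemma norm_le_coef x (B : R) : 0 <= B -> (forall i, `|coef x i| <= B) ->
  `|x| <= B * (M *+ 2).
Proof.
move=> B0 xB; apply/ler_addgt0Pr => eps eps0.
have [s [us _ xs]] := tsum_approx L_wo (idx 0%N) (coefP x) eps0.
rewrite -(subrK (\sum_(i <- s) coef x i *: e i) x) addrC.
by rewrite (le_trans (ler_normD _ _))// lerD ?norm_sum_le// ltW.
Qed.

Lemma coef_c0 x : coef x \in @c0_pred R L.
Proof.
apply/asboolP => eps eps0.
have [|s [us _ xs]] := tsum_approx L_wo (idx 0%N) (coefP x)
   (_ : 0 < eps * gap / 2).
  by rewrite divr_gt0// mulr_gt0// gap_gt0.
apply: (@sub_finite_set _ _ [set` s]); last exact: finite_seq.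
move=> g /= xg; apply: contrapT => /negP gs; move: xg; apply/negP.
rewrite -leNgt -(ler_pM2r gap_gt0).
have := coef_bound (x - \sum_(i <- s) coef x i *: e i) g.
rewrite coefB coef_sum// (negbTE gs) subr0 => /le_trans; apply.
by rewrite -mulr_natr -ler_pdivlMr// ltW.
Qed.

(** The truncations of y to the finite sets where it exceeds 1 / k give a
    Cauchy sequence by [norm_le_coef]. *)
Lemma coef_surj (y : c0 R L) : exists x, coef x = y.
Proof.
have [s sP] : {s : nat -> seq L & forall k,
    uniq (s k) /\ forall g, (g \in s k) = (k.+1%:R^-1 < `|y g|)}.
  apply: (@choice _ _ (fun k (u : seq L) =>
    uniq u /\ forall g, (g \in u) = (k.+1%:R^-1 < `|y g|))) => k.
  have /asboolP/(_ k.+1%:R^-1) := c0P y; rewrite invr_gt0 ltr0n => /(_ isT).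
  move=> /finite_seqP[u uE]; exists (undup u); split; first exact: undup_uniq.
  move=> g; rewrite mem_undup; apply/idP/idP => H.
    by have : [set` u] g by []; rewrite -uE.
  by have : [set` u] g by rewrite -uE.
pose x k := \sum_(i <- s k) y i *: e i.
have xE k g : coef (x k) g = if k.+1%:R^-1 < `|y g| then y g else 0.
  by have [us sE] := sP k; rewrite /x coef_sum// sE.
have xk k l : (k <= l)%N -> `|x k - x l| <= M *+ 2 / k.+1%:R.
  move=> kl; rewrite mulrC norm_le_coef// => g.
  rewrite coefB !xE.
  have : l.+1%:R^-1 <= k.+1%:R^-1 :> R by rewrite lef_pV2 ?posrE// ler_nat.
  case: ltP => yk; case: ltP => yl lk.
  - by rewrite subrr normr0.
  - by have := lt_le_trans yk (le_trans yl lk); rewrite ltxx.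
  - by rewrite sub0r normrN.
  - by rewrite subrr normr0.
have [z zP] := cauchy_rate_cvg xk.
exists z; apply/funext => g; apply/eqP; rewrite -subr_eq0 -normr_le0.
rewrite -(pmulr_lle0 _ gap_gt0); apply/ler_addgt0Pr => eps eps0; rewrite add0r.
have [|k /(_ _ (leqnn _))[zk kk]] := zP (eps / (gap + 2)).
  by rewrite divr_gt0// ltr_wpDl// ltW// gap_gt0.
have yk : `|coef (x k) g - y g| <= k.+1%:R^-1.
  rewrite xE; case: ltP; first by rewrite subrr normr0.
  by rewrite sub0r normrN.
have -> : coef z g - y g = coef (z - x k) g + (coef (x k) g - y g).
  by rewrite coefB addrA subrK.
apply: le_trans (ler_wpM2r (ltW gap_gt0) (ler_normD _ _)) _.
rewrite mulrDl (le_trans (lerD (coef_bound _ _) (lexx _)))//.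
rewrite (le_trans (lerD (ler_wMn2r 2 (ltW zk))
  (ler_wpM2r (ltW gap_gt0) (le_trans yk (ltW kk)))))//.
rewrite -[X in X + _]mulr_natr -mulrDr (addrC _ gap) mulfVK// gt_eqF//.
by rewrite ltr_wpDl// ltW// gap_gt0.
Qed.

End Bounded.
End SymmetricBasis.

(** * The isomorphism *)

Lemma lipschitz_linear_continuous (R : realType) (X Y : normedModType R)
    (f : {linear X -> Y}) (K : R) :
  (forall x, `|f x| <= K * `|x|) -> continuous f.
Proof.
move=> fK; apply/bounded_linear_continuous/linear_boundedP.
exists K; split=> [|r Kr x]; first exact: num_real.
by rewrite (le_trans (fK x))// ler_wpM2r// ltW.
Qed.

Lemma bijective_linear_isomorphic (R : realType) (X Y : normedModType R)
    (T : X -> Y) (K1 K2 : R) :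
  linear T -> (forall y, exists x, T x = y) ->
  (forall x, `|T x| <= K1 * `|x|) -> (forall x, `|x| <= K2 * `|T x|) ->
  linearly_isomorphic X Y.
Proof.
move=> Tlin Tsurj TK1 TK2.
pose T' : {linear X -> Y} := HB.pack T (GRing.isLinear.Build R X Y *:%R T Tlin).
have Tinj x y : T x = T y -> x = y.
  move=> Txy; apply/eqP; rewrite -subr_eq0 -normr_le0 (le_trans (TK2 _))//.
  have -> : T (x - y) = T' x - T' y by exact: (raddfB T').
  by rewrite /= Txy subrr normr0 mulr0.
have [S ST] := choice Tsurj.
have Slin : linear S.
  by move=> k x y; apply: Tinj; rewrite Tlin !ST.
pose S' : {linear Y -> X} := HB.pack S (GRing.isLinear.Build R Y X *:%R S Slin).
exists T', S'; split.
- exact: (@lipschitz_linear_continuous _ _ _ T' K1).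
- by apply: (@lipschitz_linear_continuous _ _ _ S' K2) => y; rewrite (le_trans (TK2 _))//= ST.
- by move=> x; apply: Tinj; rewrite /= ST.
- by move=> y; rewrite /= ST.
Qed.

Theorem theorem4p2 (R : realType) (X : completeNormedModType R)
    (d : Order.disp_t) (L : orderType d) (e : L -> X)
    (L_initial : initial_ordinal L)
    (X_density : has_density X L)
    (L_large : ([set: beth_omega] #<= [set: L])%card)
    (e_basis : symmetric_long_schauder_basis e)
    (X_embeds : exists (G : Type) (f : X -> c0 R G),
        coarse_embedding f \/ uniform_embedding f) :
  linearly_isomorphic X (c0 R L).
Proof.
have [L_wo _] := L_initial; have [basis e_symm] := e_basis.
have [G [f fP]] := X_embeds.
have [M balanced] := balanced_sum_bounded e_symm L_large fP.
have [h h_inj] := beth_omega_inj L_large.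
pose idx k := h (existT beth 0%N k).
have idx_inj : injective idx.
  by move=> i j /h_inj /(Eqdep_dec.inj_pair2_eq_dec _ PeanoNat.Nat.eq_dec beth).
have [coef coefP] := choice basis.
have coef_expands x : is_tsum (fun g => coef x g *: e g) x by case: (coefP x).
have coef_uniq x a : is_tsum (fun g => a g *: e g) x -> coef x = a.
  by case: (coefP x) => _; exact.
have gap0 := gap_gt0 idx_inj coef_uniq.
pose T x := C0 (coef_c0 L_wo e_symm idx_inj coef_expands coef_uniq x).
apply: (@bijective_linear_isomorphic _ _ _ T (2 / gap e idx) (M *+ 2)).
- move=> k x y; apply/val_inj/funext => g.
  exact: (coef_linear coef_expands coef_uniq).
- move=> y.
  have [x xy] := coef_surj L_wo e_symm idx_inj coef_expands coef_uniq balanced y.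
  by exists x; apply: val_inj.
- move=> x; apply: c0_norm_le => [|g].
    by rewrite mulr_ge0// divr_ge0// ltW.
  rewrite mulrAC ler_pdivlMr// mulr_natl.
  exact: (coef_bound L_wo e_symm idx_inj coef_expands).
- move=> x; rewrite mulrC.
  apply: (norm_le_coef L_wo e_symm idx_inj coef_expands coef_uniq balanced).
    exact: normr_ge0.
  exact: (c0_norm_ub (T x)).
Qed.
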